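(* There exist $2^{\aleph_0}$ finitely generated, pairwise non-isomorphic, elementarily equivalent groups $G$, each of which is a central extension of the form $$1\longrightarrow \mathbb{Z}_2\longrightarrow G\longrightarrow \mathbb{Z}^2\,\mathrm{wr}\,\mathbb{Z}\longrightarrow 1.$$
   Context: $\mathbb{Z}_2=\mathbb{Z}/2\mathbb{Z}$, and $\mathbb{Z}^2\,\mathrm{wr}\,\mathbb{Z}$ is the restricted wreath product with base group $\bigoplus_{\mathbb Z}\mathbb{Z}^2$ and active group $\mathbb{Z}$. Elementary equivalence is with respect to the first-order language of groups $\{\cdot,{}^{-1},1\}$. *)

(* Defs.v *)
From HB Require Import structures.
From mathcomp Require Import all_boot all_order all_algebra.
From mathcomp Require Import finmap.

Set Implicit Arguments.
Unset Strict Implicit.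
Unset Printing Implicit Defensive.

Local Open Scope group_scope.

Notation group_hom := UMagmaMorphism.type.

Definition isomorphic (G H : groupType) : Prop :=
  exists f : group_hom G H, bijective f.

Inductive generated (G : groupType) (s : seq G) : G -> Prop :=
  | Gen_mem x of x \in s : generated s x
  | Gen_one : generated s 1
  | Gen_mul x y of generated s x & generated s y : generated s (x * y)
  | Gen_inv x of generated s x : generated s x^-1.

Definition finitely_generated (G : groupType) : Prop :=
  exists s : seq G, forall x : G, generated s x.

(* 1 -> A -> G -> Q -> 1 is exact and the image of A is central in G. *)
Definition central_extension (A G Q : groupType) : Prop :=
  exists (i : group_hom A G) (p : group_hom G Q),
    [/\ injective i,
        forall g : G, p g = 1 <-> exists a : A, i a = g,
        forall q : Q, exists g : G, p g = q
      & forall (a : A) (g : G), commute (i a) g].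

(* First-order formulas over the language {*, ^-1, 1}, with variables named
   by natural numbers. *)
Inductive term : Type :=
  | Var of nat
  | One
  | Mul of term & term
  | Inv of term.

Inductive formula : Type :=
  | Equal of term & term
  | Not of formula
  | And of formula & formula
  | Or of formula & formula
  | Implies of formula & formula
  | Forall of nat & formula
  | Exists of nat & formula.

Fixpoint term_vars (t : term) : seq nat :=
  match t with
  | Var k => [:: k]
  | One => [::]
  | Mul t1 t2 => term_vars t1 ++ term_vars t2
  | Inv t1 => term_vars t1
  end.

Fixpoint free_vars (phi : formula) : seq nat :=
  match phi with
  | Equal t1 t2 => term_vars t1 ++ term_vars t2
  | Not phi1 => free_vars phi1
  | And phi1 phi2 | Or phi1 phi2 | Implies phi1 phi2 =>
      free_vars phi1 ++ free_vars phi2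
  | Forall k phi1 | Exists k phi1 => [seq j <- free_vars phi1 | j != k]
  end.

Definition sentence (phi : formula) : Prop := free_vars phi = [::].

Fixpoint eval (G : groupType) (e : nat -> G) (t : term) : G :=
  match t with
  | Var k => e k
  | One => 1
  | Mul t1 t2 => eval e t1 * eval e t2
  | Inv t1 => (eval e t1)^-1
  end.

Fixpoint holds (G : groupType) (e : nat -> G) (phi : formula) : Prop :=
  match phi with
  | Equal t1 t2 => eval e t1 = eval e t2
  | Not phi1 => ~ holds e phi1
  | And phi1 phi2 => holds e phi1 /\ holds e phi2
  | Or phi1 phi2 => holds e phi1 \/ holds e phi2
  | Implies phi1 phi2 => holds e phi1 -> holds e phi2
  | Forall k phi1 => forall x : G, holds [eta e with k |-> x] phi1
  | Exists k phi1 => exists x : G, holds [eta e with k |-> x] phi1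
  end.

(* The truth value of a sentence does not depend on the valuation, so quantifying
   over all valuations gives satisfaction. *)
Definition satisfies (G : groupType) (phi : formula) : Prop :=
  forall e : nat -> G, holds e phi.

Definition elementarily_equivalent (G H : groupType) : Prop :=
  forall phi : formula, sentence phi -> (satisfies G phi <-> satisfies H phi).

(* Restricted wreath product A wr B: the base group of finitely supported
   functions B -> A is acted on by b : B through (b . f) x = f (b^-1 * x), and
   (f, b) * (g, c) = (f * (b . g), b * c). *)
Definition wreath (A B : groupType) : Type :=
  ({fsfun B -> A with 1} * B)%type.

Section Wreath.
Variables A B : groupType.
Local Open Scope fset_scope.
Local Notation base := {fsfun B -> A with 1}.
Implicit Types (f g : base) (b c : B) (u v w : wreath A B).

Definition base_act b f : base :=
  [fsfun x in [fset b * y | y in finsupp f] => f (b^-1 * x)].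

Lemma base_actE b f x : base_act b f x = f (b^-1 * x).
Proof.
rewrite fsfun_fun; case: ifPn => // bfx.
rewrite fsfun_dflt //; apply: contra bfx => fx.
by apply/imfsetP; exists (b^-1 * x); rewrite //= mulVKg.
Qed.

Definition base_mul f g : base :=
  [fsfun x in finsupp f `|` finsupp g => f x * g x].

Lemma base_mulE f g x : base_mul f g x = f x * g x.
Proof.
rewrite fsfun_fun; case: ifPn => //.
by rewrite in_fsetU negb_or => /andP[/fsfun_dflt-> /fsfun_dflt->]; rewrite mulg1.
Qed.

Definition base_inv f : base := [fsfun x in finsupp f => (f x)^-1].

Lemma base_invE f x : base_inv f x = (f x)^-1.
Proof.
by rewrite fsfun_fun; case: ifPn => // /fsfun_dflt->; rewrite invg1.
Qed.

Definition wreath_one : wreath A B := ([fsfun], 1).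
Definition wreath_mul u v : wreath A B :=
  (base_mul u.1 (base_act u.2 v.1), u.2 * v.2).
Definition wreath_inv u : wreath A B :=
  (base_act u.2^-1 (base_inv u.1), u.2^-1).

Let baseE := (base_mulE, base_actE, base_invE, fsfun0E).

Lemma wreath_mulA : associative wreath_mul.
Proof.
move=> u v w; congr pair; last exact: mulgA.
by apply/fsfunP => x; rewrite !baseE invgM !mulgA.
Qed.

Lemma wreath_mul1 : left_id wreath_one wreath_mul.
Proof.
move=> [f b]; congr pair; last exact: mul1g.
by apply/fsfunP => x; rewrite !baseE /= mul1g invg1 mul1g.
Qed.

Lemma wreath_mulr1 : right_id wreath_one wreath_mul.
Proof.
move=> [f b]; congr pair; last exact: mulg1.
by apply/fsfunP => x; rewrite !baseE mulg1.
Qed.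

Lemma wreath_mulV : left_inverse wreath_one wreath_inv wreath_mul.
Proof.
move=> [f b]; congr pair; last exact: mulVg.
by apply/fsfunP => x; rewrite !baseE mulVg.
Qed.

Lemma wreath_mulrV : right_inverse wreath_one wreath_inv wreath_mul.
Proof.
move=> [f b]; congr pair; last exact: mulgV.
by apply/fsfunP => x; rewrite !baseE /= invgK mulVKg mulgV.
Qed.

HB.instance Definition _ := Choice.on (wreath A B).
HB.instance Definition _ := isGroup.Build (wreath A B)
  wreath_mulA wreath_mul1 wreath_mulr1 wreath_mulV wreath_mulrV.

End Wreath.

Definition Zgrp : groupType := Algebra.to_multiplicative int.
Definition Zsq_grp : groupType := (Zgrp * Zgrp)%type.
Definition Zmod2_grp : groupType := Algebra.to_multiplicative 'Z_2.

(* Main.v *)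
Require Import Defs.
From HB Require Import structures.
From mathcomp Require Import all_boot all_order all_algebra.
From mathcomp Require Import finmap boolp zify ring.

(** For a subset [phi] of the integers, let [ext phi] be the central extension of
    the wreath product by [Z_2] in which the lamps generated by the first
    generators of [Z^2] commute with each other, so do those of the second
    generators, and the commutator of the first generator at position [i] with
    the second one at position [j] is [phi (j - i)].  It is given by a cocycle
    built from the bilinear form [form phi].  All these groups are finitely
    generated, and they have the same countable underlying set.

    Two facts make a Baire category argument work.  Conjugating one generator by
    a power of the generator of the acting group shows that [phi] and its shifts
    define isomorphic groups ([isomorphic_shift]).  Moreover each value of [phi]
    is visible from the images of three elements under an isomorphism
    ([isomorphic_commutes]), so that an isomorphism type arises from
    countably many [phi] only.

    Fix a formula.  As every product in [ext phi] depends on finitely many values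
    of [phi] and the underlying set is countable, the set of those [phi] for which
    the formula is true has the Baire property ([baire_holds]).  This set is
    invariant under shifts, and some shift of any basic open set meets any other
    one; hence the set is meager or comeager ([zero_one_law]).  There being
    countably many formulas, all [phi] in some comeager set define elementarily
    equivalent groups ([comeager_elementarily_equivalent]).  For generic pairs the
    groups are not isomorphic: given three elements of [ext psi], finitely many
    values of [psi] decide what they predict for a value of [phi] which is still
    free ([dense_interior_commutes]).  Mycielski's theorem ([perfect_set]) then
    gives a family, indexed by the binary sequences, of generic points which are
    pairwise generic. *)

Set Implicit Arguments.
Unset Strict Implicit.
Unset Printing Implicit Defensive.

Import GRing.Theory.

(** * Baire category in the Cantor space of subsets of the integers *)

Definition cantor : Type := int -> bool.

Implicit Types (phi psi chi : cantor) (m n : nat).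

(** The basic open neighbourhoods of [phi] are the sets [agree n phi]. *)
Definition agree n phi psi : Prop := forall k : int, (`|k| <= n)%N -> phi k = psi k.

Lemma agree_sym n phi psi : agree n phi psi -> agree n psi phi.
Proof. by move=> h k /h. Qed.

Lemma agree_trans n psi phi chi :
  agree n phi psi -> agree n psi chi -> agree n phi chi.
Proof. by move=> h1 h2 k hk; rewrite h1 // h2. Qed.

Lemma agree_le m n phi psi : (m <= n)%N -> agree n phi psi -> agree m phi psi.
Proof. by move=> mn h k km; apply: h; apply: leq_trans mn. Qed.

(** The power [T -> cantor] serves to handle all the nodes of a level of a tree
    simultaneously, so [T] will be [seq bool]; the window is common to all the
    coordinates.  For a finite [T] these are the sets with dense interior in the
    product topology. *)
Definition dense_interior (T : Type) (Q : (T -> cantor) -> Prop) : Prop :=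
  forall (P : T -> cantor) n, exists (P' : T -> cantor) m,
    [/\ (n <= m)%N, forall t, agree n (P t) (P' t)
      & forall P'', (forall t, agree m (P' t) (P'' t)) -> Q P''].

Lemma dense_interior_le (T : Type) (Q Q' : (T -> cantor) -> Prop) :
  (forall P, Q P -> Q' P) -> dense_interior Q -> dense_interior Q'.
Proof.
move=> QQ' dQ P n; have [P' [m [nm PP' hQ]]] := dQ P n.
by exists P', m; split=> // P'' /hQ /QQ'.
Qed.

Lemma dense_interiorI (T : Type) (Q Q' : (T -> cantor) -> Prop) :
  dense_interior Q -> dense_interior Q' -> dense_interior (fun P => Q P /\ Q' P).
Proof.
move=> dQ dQ' P n; have [P1 [n1 [nn1 PP1 hQ]]] := dQ P n.
have [P2 [n2 [n12 P12 hQ']]] := dQ' P1 n1.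
exists P2, n2; split; first exact: leq_trans n12.
- by move=> t; apply: agree_trans (PP1 t) (agree_le nn1 (P12 t)).
- move=> P3 P23; split; last exact: hQ'.
  by apply: hQ => t; apply: agree_trans (P12 t) (agree_le n12 (P23 t)).
Qed.

Lemma dense_interior_all (T : Type) (I : eqType) (r : seq I)
    (Q : I -> (T -> cantor) -> Prop) :
  {in r, forall i, dense_interior (Q i)} ->
  dense_interior (fun P => {in r, forall i, Q i P}).
Proof.
elim: r => [_ P n|i r IH dQ]; first by exists P, n.
have dr : dense_interior (fun P => {in r, forall i, Q i P}).
  by apply: IH => j jr; apply: dQ; rewrite inE jr orbT.
have di : dense_interior (Q i) by apply: dQ; rewrite mem_head.
apply: dense_interior_le (dense_interiorI di dr) => P [Qi Qr] j.
by rewrite inE => /predU1P[->|/Qr].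
Qed.

Definition dense_interior1 (D : cantor -> Prop) : Prop :=
  forall phi n, exists psi m,
    [/\ (n <= m)%N, agree n phi psi & forall chi, agree m psi chi -> D chi].

Definition dense_interior2 (E : cantor -> cantor -> Prop) : Prop :=
  forall phi psi n, exists phi' psi' m,
    [/\ (n <= m)%N, agree n phi phi', agree n psi psi' &
      forall chi chi', agree m phi' chi -> agree m psi' chi' -> E chi chi'].

Lemma dense_interior_proj1 (T : eqType) (D : cantor -> Prop) (t : T) :
  dense_interior1 D -> dense_interior (fun P : T -> cantor => D (P t)).
Proof.
move=> dD P n; have [psi [m [nm Ppsi hD]]] := dD (P t) n.
exists (fun u => if u == t then psi else P u), m; split=> //.
- by move=> u; case: eqP => [->|].
- by move=> P'' /(_ t); rewrite eqxx => /hD.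
Qed.

Lemma dense_interior_proj2 (T : eqType) (E : cantor -> cantor -> Prop) (t u : T) :
  t != u -> dense_interior2 E ->
  dense_interior (fun P : T -> cantor => E (P t) (P u)).
Proof.
move=> tu dE P n; have [phi [psi [m [nm Pphi Ppsi hE]]]] := dE (P t) (P u) n.
exists (fun v => if v == t then phi else if v == u then psi else P v), m.
split=> //.
- by move=> v; case: eqP => [->|_] //; case: eqP => [->|].
- move=> P'' hP; have := hP t; have := hP u.
  by rewrite eqxx eq_sym (negPf tu) eqxx => h1 h2; apply: hE.
Qed.

Definition comeager (A : cantor -> Prop) : Prop :=
  exists2 D : nat -> cantor -> Prop, forall i, dense_interior1 (D i)
    & forall phi, (forall i, D i phi) -> A phi.

Lemma comeager_dense_interior D : dense_interior1 D -> comeager D.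
Proof. by move=> dD; exists (fun=> D) => // phi; apply; apply: 0%N. Qed.

Lemma comeager_true (A : cantor -> Prop) : (forall phi, A phi) -> comeager A.
Proof.
move=> hA; apply: comeager_dense_interior => phi n.
by exists phi, n; split.
Qed.

Lemma comeager_le (A A' : cantor -> Prop) :
  (forall phi, A phi -> A' phi) -> comeager A -> comeager A'.
Proof. by move=> AA' [D dD DA]; exists D => // phi /DA /AA'. Qed.

Lemma comeager_bigcap (I : Type) (code : I -> nat) (A : I -> cantor -> Prop) :
  injective code -> (forall i, comeager (A i)) ->
  comeager (fun phi => forall i, A i phi).
Proof.
move=> codeI cA.
have /choice[D hD] : forall i, exists D : nat -> cantor -> Prop,
    (forall j, dense_interior1 (D j)) /\ (forall phi, (forall j, D j phi) -> A i phi).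
  by move=> i; have [D dD DA] := cA i; exists D.
(* The doubly indexed family of dense open sets is listed by codes of pairs. *)
exists (fun n phi => forall i j, n = choice.pickle (code i, j) -> D i j phi);
  last first.
  by move=> phi hphi i; apply: (hD i).2 => j; apply: hphi.
move=> n; have [[i [j nij]]|none] :=
  EM (exists i (j : nat), n = choice.pickle (code i, j)).
  move=> phi m; have [psi [m' [mm' h hDij]]] := (hD i).1 j phi m.
  exists psi, m'; split=> // chi /hDij Dchi i' j'.
  by rewrite nij => /(pcan_inj choice.pickleK)[/codeI <- <-].
move=> phi m; exists phi, m; split=> // chi _ i j nij.
by case: none; exists i, j.
Qed.

Lemma comeagerI (A A' : cantor -> Prop) :
  comeager A -> comeager A' -> comeager (fun phi => A phi /\ A' phi).
Proof.
move=> cA cA'.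
have := @comeager_bigcap bool nat_of_bool (fun b => if b then A else A').
move=> /(_ _ _)/comeager_le; apply=> [phi h|[] []|[]] //.
by split; [apply: (h true)|apply: (h false)].
Qed.

(** The sets [mem S], for a finite list [S], form a countable dense set of
    centres for the basic neighbourhoods. *)
Lemma agree_list n phi : exists S : seq int, agree n phi (mem S).
Proof.
exists [seq k <- [seq Posz i | i <- iota 0 n.+1] ++ [seq - Posz i | i <- iota 0 n.+1]
       | phi k]%R => k kn.
rewrite -[RHS]/(k \in _) mem_filter mem_cat; case: (phi k) => //; symmetry; apply/orP.
by case: k kn => i kn; [left|right]; apply/mapP;
   [exists i|exists i.+1]; rewrite ?mem_iota //= NegzE.
Qed.

(** Banach category theorem: the space has a countable base, so a
    set which is comeager near every point of a dense open set is comeager. *)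
Lemma comeager_local (A : cantor -> Prop) :
  (forall phi n, exists psi m, [/\ (n <= m)%N, agree n phi psi
     & comeager (fun chi => agree m psi chi -> A chi)]) ->
  comeager A.
Proof.
move=> locA.
pose good (p : seq int * nat) := comeager (fun chi => agree p.2 (mem p.1) chi -> A chi).
have c1 : comeager (fun chi => forall p, good p -> agree p.2 (mem p.1) chi -> A chi).
  apply: (@comeager_bigcap _ choice.pickle _ (pcan_inj choice.pickleK)) => p.
  have [gp|ngp] := EM (good p); first by apply: comeager_le gp => chi h _.
  by apply: comeager_true => chi.
have c2 : comeager (fun chi => exists2 p, good p & agree p.2 (mem p.1) chi).
  apply: comeager_dense_interior => phi n.
  have [psi [m [nm h cA]]] := locA phi n.
  have [S psiS] := agree_list m psi.
  exists psi, m; split=> // chi psichi; exists (S, m) => /=.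
    by apply: comeager_le cA => xi hxi /(agree_trans psiS) /hxi.
  exact: agree_trans (agree_sym psiS) psichi.
by apply: comeager_le (comeagerI c1 c2) => chi [h [p /h hp /hp]].
Qed.

(** This amounts to the Baire property: [A] agrees with an open set outside a
    meager set.  The local form is the one that passes through intersections. *)
Definition baire (A : cantor -> Prop) : Prop :=
  forall phi n, exists psi m, [/\ (n <= m)%N, agree n phi psi
    & comeager (fun chi => agree m psi chi -> A chi) \/
      comeager (fun chi => agree m psi chi -> ~ A chi)].

Lemma baire_iff (A A' : cantor -> Prop) :
  (forall phi, A phi <-> A' phi) -> baire A -> baire A'.
Proof.
move=> AA' bA phi n; have [psi [m [nm h hA]]] := bA phi n.
exists psi, m; split=> //; case: hA => hA; [left|right];
  by apply: comeager_le hA => chi hchi /hchi; rewrite AA'.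
Qed.

Lemma baire_compl (A : cantor -> Prop) : baire A -> baire (fun phi => ~ A phi).
Proof.
move=> bA phi n; have [psi [m [nm h hA]]] := bA phi n.
exists psi, m; split=> //; case: hA => hA; [right|left] => //.
by apply: comeager_le hA => chi hchi /hchi + nA.
Qed.

Lemma baire_clopen (A : cantor -> Prop) :
  (forall phi, exists n, forall psi, agree n phi psi -> (A phi <-> A psi)) -> baire A.
Proof.
move=> cA phi n; have [m hm] := cA phi.
exists phi, (maxn n m); split; rewrite ?leq_maxl //.
by have [Ap|nAp] := EM (A phi); [left|right]; apply: comeager_true => chi hchi;
  rewrite -(hm chi) //; apply: agree_le hchi; apply: leq_maxr.
Qed.

(** If no neighbourhood inside [agree n phi] makes some [A i] generically false,
    then each [A i] is generically true throughout [agree n phi]. *)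
Lemma baire_bigcap (I : Type) (code : I -> nat) (A : I -> cantor -> Prop) :
  injective code -> (forall i, baire (A i)) -> baire (fun phi => forall i, A i phi).
Proof.
move=> codeI bA phi n.
have [[i [psi [m [nm h hA]]]]|none] := EM (exists i psi m,
  [/\ (n <= m)%N, agree n phi psi & comeager (fun chi => agree m psi chi -> ~ A i chi)]).
  exists psi, m; split=> //; right.
  by apply: comeager_le hA => chi hchi /hchi nA hall; apply: nA.
exists phi, n; split=> //; left.
suff: comeager (fun chi => forall i, agree n phi chi -> A i chi).
  by apply: comeager_le => chi h hn i; apply: h.
apply: (comeager_bigcap codeI) => i; apply: comeager_local => psi m.
have [[chi psichi phichi]|disj] := EM (exists2 chi, agree m psi chi & agree n phi chi).
  have [xi [l [ml h hA]]] := bA i chi (maxn m n).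
  have mlm : (m <= l)%N by apply: leq_trans ml; apply: leq_maxl.
  exists xi, l; split=> //.
    by apply: agree_trans psichi _; apply: agree_le h; apply: leq_maxl.
  case: hA => hA; first by apply: comeager_le hA => x hx /hx.
  case: none; exists i, xi, l; split=> //.
    by apply: leq_trans ml; apply: leq_maxr.
  by apply: agree_trans phichi _; apply: agree_le h; apply: leq_maxr.
exists psi, m; split=> //; apply: comeager_true => chi psichi phichi.
by case: disj; exists chi.
Qed.

Definition shift (d : int) phi : cantor := fun k => phi (k + d)%R.

Lemma shiftK d phi : shift (- d)%R (shift d phi) = phi.
Proof. by apply: funext => k; rewrite /shift addrNK. Qed.

Lemma shiftKV d phi : shift d (shift (- d)%R phi) = phi.
Proof. by apply: funext => k; rewrite /shift addrK. Qed.

Lemma agree_shift d n phi psi :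
  agree (n + `|d|) phi psi -> agree n (shift d phi) (shift d psi).
Proof. by move=> h k kn; apply: h; lia. Qed.

Lemma comeager_shift d (A : cantor -> Prop) :
  comeager A -> comeager (fun phi => A (shift d phi)).
Proof.
move=> [D dD DA]; exists (fun i phi => D i (shift d phi)); last by move=> phi /DA.
move=> i phi n; have [psi [m [nm h hD]]] := dD i (shift d phi) (n + `|d|)%N.
exists (shift (- d)%R psi), (m + `|d|)%N; split; first by lia.
- by rewrite -[phi](shiftK d); apply: agree_shift; rewrite abszN.
- by move=> chi /agree_shift; rewrite shiftKV => /hD.
Qed.

(** Two basic open sets constrain finitely many coordinates each, so a large
    shift of the second one meets the first one; hence a shift-invariant set
    which is generically true somewhere is generically true everywhere. *)
Lemma zero_one_law (A : cantor -> Prop) :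
  (forall d phi, A phi -> A (shift d phi)) -> baire A ->
  comeager A \/ comeager (fun phi => ~ A phi).
Proof.
move=> invA bA.
have [[phi0 [n0 hA]]|none] :=
  EM (exists phi0 n0, comeager (fun chi => agree n0 phi0 chi -> A chi)).
  left; apply: comeager_local => phi n.
  (* The window of radius [n0] around [d] is disjoint from that of radius [n]
     around 0. *)
  pose d := Posz (n + n0).+1.
  pose psi : cantor := fun k => if (`|k| <= n)%N then phi k else phi0 (k - d)%R.
  exists psi, (n0 + (n + n0).+1)%N; split; first by lia.
    by move=> k kn; rewrite /psi kn.
  apply: comeager_le (comeager_shift d hA) => chi hchi psichi.
  rewrite -(shiftK d chi); apply: invA; apply: hchi => k kn0.
  rewrite /shift -psichi; last by rewrite /d; lia.
  by rewrite /psi ifF ?addrK // /d; lia.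
right; apply: comeager_local => phi n.
have [psi [m [nm h [hA|hA]]]] := bA phi n; last by exists psi, m.
by case: none; exists psi, m.
Qed.

(** * Perfect sets of generic points *)

Section PerfectSet.
Variables (D : nat -> cantor -> Prop) (E : nat -> cantor -> cantor -> Prop).
Hypotheses (dD : forall i, dense_interior1 (D i)) (dE : forall j, dense_interior2 (E j)).

Let node (N : nat) (s : nat -> bool) : seq bool := mkseq s N.

Definition level_generic N (P : seq bool -> cantor) : Prop :=
  (forall s, D N (P (node N s))) /\
  (forall s t j, (j < N)%N -> node N s != node N t -> E j (P (node N s)) (P (node N t))).

Lemma dense_level_generic N : dense_interior (level_generic N).
Proof.
pose nodes := [seq val x | x : N.-tuple bool].
have mem_node s : node N s \in nodes.
  have sz : size (node N s) == N by rewrite size_mkseq.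
  by apply/mapP; exists (Tuple sz); rewrite ?mem_enum.
have dl1 : dense_interior (fun P => {in nodes, forall x, D N (P x)}).
  apply: (@dense_interior_all _ _ _ (fun x P => D N (P x))) => x _.
  exact: dense_interior_proj1.
have dl2 : dense_interior (fun P => {in [seq (x, y) | x <- nodes, y <- nodes], forall q,
    {in iota 0 N, forall j, q.1 != q.2 -> E j (P q.1) (P q.2)}}).
  apply: (@dense_interior_all _ _ _ (fun (q : seq bool * seq bool) P =>
    {in iota 0 N, forall j, q.1 != q.2 -> E j (P q.1) (P q.2)})) => -[x y] _ /=.
  apply: (@dense_interior_all _ _ _ (fun j P => x != y -> E j (P x) (P y))) => j _.
  have [xy|xy] := boolP (x != y); last by move=> P n; exists P, n.
  by apply: dense_interior_le (dense_interior_proj2 xy (dE j)).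
apply: dense_interior_le (dense_interiorI dl1 dl2) => P [h1 h2]; split=> [s|s t j jN st].
  by apply: h1; apply: mem_node.
apply: (h2 (node N s, node N t)) => //; last by rewrite mem_iota.
by apply: allpairs_f; apply: mem_node.
Qed.

(** Mycielski's theorem.  A binary tree of basic open sets is built level by
    level: level [N] refines level [N - 1], and every choice of points in its
    boxes satisfies the [N]-th condition on points and the first [N] conditions
    on pairs. *)
Theorem perfect_set : exists F : (nat -> bool) -> cantor,
  (forall s i, D i (F s)) /\ (forall s t, s <> t -> forall j, E j (F s) (F t)).
Proof.
pose state := ((seq bool -> cantor) * nat)%type.
pose box N (x : state) := forall P, (forall t, agree x.2 (x.1 t) (P t)) -> level_generic N P.
have /choice[next hnext] : forall a : nat * state, exists y : state,
    [/\ (a.2.2 < y.2)%N, forall t, agree a.2.2 (a.2.1 (take a.1 t)) (y.1 t) & box a.1.+1 y].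
  move=> [N [P n]] /=.
  have [P' [m [nm PP' hP']]] :=
    @dense_level_generic N.+1 (fun t => P (take N t)) n.+1.
  exists (P', m); split=> // t; exact: agree_le (PP' t).
have [P0 [m0 [_ _ h0]]] := @dense_level_generic 0 (fun _ _ => false) 0.
pose x := fix x N : state := if N is N'.+1 then next (N', x N') else (P0, m0).
have boxx N : box N (x N).
  by case: N => [|N]; [apply: h0|case: (hnext (N, x N))].
have window N : (N <= (x N).2)%N.
  by elim: N => // N IH; case: (hnext (N, x N)) => /= h _ _; apply: leq_ltn_trans h.
have windowS N : ((x N).2 <= (x N.+1).2)%N by case: (hnext (N, x N)) => /= /ltnW.
have step s N : agree (x N).2 ((x N).1 (node N s)) ((x N.+1).1 (node N.+1 s)).
  have [_ /(_ (node N.+1 s)) + _] := hnext (N, x N).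
  by rewrite /= /node /mkseq -map_take take_iota (minn_idPl (leqnSn N)).
have steps s N N' : (N <= N')%N ->
    (x N).2 <= (x N').2 /\ agree (x N).2 ((x N).1 (node N s)) ((x N').1 (node N' s)).
  elim: N' => [|N' IH]; first by rewrite leqn0 => /eqP->.
  rewrite leq_eqVlt => /predU1P[->//|]; rewrite ltnS => /IH[h1 h2].
  split; first exact: leq_trans (windowS N').
  by apply: agree_trans h2 _; apply: agree_le h1 _; apply: step.
(* The coordinate [k] is settled from level [`|k|] on, because the window of
   level [N] has radius at least [N]. *)
pose F s : cantor := fun k => (x `|k|%N).1 (node `|k|%N s) k.
have hF s N : agree (x N).2 ((x N).1 (node N s)) (F s).
  move=> k kN; have [le|/ltnW le] := leqP N `|k|%N.
    by have [_ ->] := steps s _ _ le.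
  by symmetry; have [_] := steps s _ _ le; apply; apply: window.
exists F; split=> [s i|s t st j].
  pose P u := if u == node i s then F s else (x i).1 u.
  have /(_ P)[] := boxx i.
    by move=> u; rewrite /P; case: eqP => [->|].
  by move=> /(_ s); rewrite /P eqxx.
have [i sti] : exists i, s i != t i.
  by apply: contrapT => /forallNP none; apply: st; apply: funext => i;
     apply/eqP/negPn/negP; apply: none.
pose N := (maxn i j).+1.
have Nst : node N s != node N t.
  apply: contra sti => /eqP/(congr1 (nth false ^~ i)).
  by rewrite !nth_mkseq ?ltnS ?leq_maxl // => ->.
pose P u := if u == node N s then F s else if u == node N t then F t else (x N).1 u.
have /(_ P)[] := boxx N.
  by move=> u; rewrite /P; case: eqP => [->|_] //; case: eqP => [->|].
move=> _ /(_ s t j); rewrite /P !eqxx [node N t == _]eq_sym (negPf Nst); apply=> //.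
by rewrite ltnS leq_maxr.
Qed.

End PerfectSet.
(** * Finite generation *)

Section FiniteGeneration.
Local Open Scope group_scope.

Lemma generated_sub (G : groupType) (s s' : seq G) x :
  {subset s <= s'} -> generated s x -> generated s' x.
Proof.
move=> ss'; elim=> [y /ss'|||].
- exact: Gen_mem.
- exact: Gen_one.
- by move=> y z _ hy _ hz; apply: Gen_mul.
- by move=> y _; apply: Gen_inv.
Qed.

Lemma generated_map (G H : groupType) (f : group_hom G H) (s : seq G) x :
  generated s x -> generated (map f s) (f x).
Proof.
elim=> [y ys|||].
- by apply: Gen_mem; apply: map_f.
- by rewrite gmulf1; apply: Gen_one.
- by move=> y z _ hy _ hz; rewrite gmulfM; apply: Gen_mul.
- by move=> y _ hy; rewrite gmulfV; apply: Gen_inv.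
Qed.

(** The kernel and lifts of generators of the quotient generate. *)
Lemma fg_central_extension (A G Q : groupType) :
  finitely_generated A -> finitely_generated Q -> central_extension A G Q ->
  finitely_generated G.
Proof.
move=> [sA hA] [sQ hQ] [i [p [_ ker_p surj_p _]]].
have /choice[lift liftK] := surj_p.
exists (map i sA ++ map lift sQ) => g.
suff [g' hg' pg'] : exists2 g', generated (map i sA ++ map lift sQ) g' & p g' = p g.
  have [a ia] : exists a, i a = g * g'^-1.
    by apply/(ker_p _); rewrite gmulfM gmulfV pg' mulgV.
  rewrite -[g](mulgVK g') -ia; apply: Gen_mul => //.
  by apply: generated_sub (generated_map i (hA a)) => y ys; rewrite mem_cat ys.
elim: (hQ (p g)) => [q qs|||].
- exists (lift q) => //; apply: Gen_mem.
  by rewrite mem_cat (map_f lift qs) orbT.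
- by exists 1; [apply: Gen_one|rewrite gmulf1].
- move=> q r _ [x hx <-] _ [y hy <-].
  by exists (x * y); [apply: Gen_mul|rewrite gmulfM].
- move=> q _ [x hx <-].
  by exists x^-1; [apply: Gen_inv|rewrite gmulfV].
Qed.

Lemma fg_finite (G : groupType) (s : seq G) : (forall x, x \in s) -> finitely_generated G.
Proof. by move=> hs; exists s => x; apply: Gen_mem. Qed.

Lemma fg_prod (G H : groupType) :
  finitely_generated G -> finitely_generated H -> finitely_generated (G * H)%type.
Proof.
move=> [s hs] [s' hs'].
exists ([seq (x, 1) | x <- s] ++ [seq (1, y) | y <- s']) => -[x y].
have -> : (x, y) = (x, 1) * (1, y) :> G * H by congr pair; rewrite /= ?mulg1 ?mul1g.
apply: Gen_mul.
- elim: (hs x) => [z zs|||].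
  + by apply: Gen_mem; rewrite mem_cat map_f.
  + exact: Gen_one.
  + move=> z w _ hz _ hw.
    have -> : (z * w, 1) = (z, 1) * (w, 1) :> G * H by congr pair; rewrite /= mulg1.
    exact: Gen_mul.
  + move=> z _ hz.
    have -> : (z^-1, 1) = (z, 1)^-1 :> G * H by congr pair; rewrite /= invg1.
    exact: Gen_inv.
- elim: (hs' y) => [z zs|||].
  + by apply: Gen_mem; rewrite mem_cat map_f ?orbT.
  + exact: Gen_one.
  + move=> z w _ hz _ hw.
    have -> : (1, z * w) = (1, z) * (1, w) :> G * H by congr pair; rewrite /= mulg1.
    exact: Gen_mul.
  + move=> z _ hz.
    have -> : (1, z^-1) = (1, z)^-1 :> G * H by congr pair; rewrite /= invg1.
    exact: Gen_inv.
Qed.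

Lemma fg_Zgrp : finitely_generated Zgrp.
Proof.
exists [:: 1%Z : Zgrp].
have hn n : generated [:: 1%Z : Zgrp] (Posz n : Zgrp).
  elim: n => [|n IH]; first exact: Gen_one.
  by rewrite -[n.+1]addn1 PoszD; apply: (@Gen_mul Zgrp _ (Posz n) 1%Z) => //;
    apply: Gen_mem; rewrite mem_head.
by case=> n //; rewrite NegzE; apply: (@Gen_inv Zgrp _ (Posz n.+1)).
Qed.

End FiniteGeneration.

(** * Wreath products *)

Section WreathTheory.
Variables A B : groupType.
Local Open Scope group_scope.
Local Open Scope fset_scope.
Local Notation base := {fsfun B -> A with 1}.
Implicit Types (f g : base) (b c : B).

Local Notation elt f b := ((f : base, b : B) : wreath A B).

Lemma base_actM b c f : base_act (b * c) f = base_act b (base_act c f).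
Proof. by apply/fsfunP => x; rewrite !base_actE invgM mulgA. Qed.

Lemma base_act1 f : base_act 1 f = f.
Proof. by apply/fsfunP => x; rewrite base_actE invg1 mul1g. Qed.

Lemma base_act_mul b f g : base_act b (base_mul f g) = base_mul (base_act b f) (base_act b g).
Proof. by apply/fsfunP => x; rewrite !(base_actE, base_mulE). Qed.

Lemma base_act_one b : base_act b [fsfun] = [fsfun] :> base.
Proof. by apply/fsfunP => x; rewrite base_actE !fsfun0E. Qed.

Lemma base_mul1 f : base_mul f [fsfun] = f.
Proof. by apply/fsfunP => x; rewrite base_mulE fsfun0E mulg1. Qed.

Lemma base_1mul f : base_mul [fsfun] f = f.
Proof. by apply/fsfunP => x; rewrite base_mulE fsfun0E mul1g. Qed.

Lemma finsupp_base_act b f : finsupp (base_act b f) = [fset b * y | y in finsupp f].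
Proof.
apply/fsetP => x; rewrite mem_finsupp base_actE.
apply/idP/imfsetP => [h|[y /= + ->]]; last by rewrite mulKg mem_finsupp.
by exists (b^-1 * x); rewrite /= ?mem_finsupp // mulVKg.
Qed.

Definition base_delta (x : B) (a : A) : base := [fsfun [fsfun] with x |-> a].

Lemma base_deltaE x a y : base_delta x a y = if y == x then a else 1.
Proof. by rewrite fsfun_withE fsfun0E. Qed.

Lemma base_deltaM x a a' : base_delta x (a * a') = base_mul (base_delta x a) (base_delta x a').
Proof.
by apply/fsfunP => y; rewrite base_mulE !base_deltaE; case: eqP; rewrite ?mulg1.
Qed.

Lemma base_delta1 x : base_delta x 1 = [fsfun].
Proof. by apply/fsfunP => y; rewrite base_deltaE fsfun0E if_same. Qed.

Lemma base_act_delta b x a : base_act b (base_delta x a) = base_delta (b * x) a.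
Proof.
apply/fsfunP => y; rewrite base_actE !base_deltaE.
by congr (if _ then _ else _); apply/eqP/eqP => [<-|->]; rewrite ?mulVKg ?mulKg.
Qed.

Lemma wreathM (u v : wreath A B) : u * v = (base_mul u.1 (base_act u.2 v.1), u.2 * v.2).
Proof. by []. Qed.

Lemma wreath_conj b f :
  elt [fsfun] b * elt f 1 * (elt [fsfun] b)^-1 = elt (base_act b f) 1.
Proof.
apply: (canLR (mulgK _)); rewrite !wreathM /= base_1mul base_act_one base_mul1.
by rewrite mulg1 mul1g.
Qed.

(** The conjugates of the copy of [A] at the neutral coordinate by the acting
    group are the other coordinate subgroups. *)
Lemma fg_wreath :
  finitely_generated A -> finitely_generated B -> finitely_generated (wreath A B).
Proof.
move=> [s hs] [s' hs'].
exists ([seq elt (base_delta 1 a) 1 | a <- s] ++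
        [seq elt [fsfun] b | b <- s']) => -[f b].
set S := _ ++ _.
have genB c : generated S (elt [fsfun] c).
  elim: (hs' c) => [y ys|||].
  - by apply: Gen_mem; rewrite mem_cat map_f ?orbT.
  - exact: Gen_one.
  - move=> y z _ hy _ hz.
    have -> : elt [fsfun] (y * z) = elt [fsfun] y * elt [fsfun] z.
      by rewrite wreathM /= base_act_one base_mul1.
    exact: Gen_mul.
  - move=> y _ hy.
    have -> : elt [fsfun] (y^-1) = (elt [fsfun] y)^-1.
      apply/esym/mulg1_eq; rewrite wreathM /= base_act_one base_mul1 mulgV //.
    exact: Gen_inv.
have genA a : generated S (elt (base_delta 1 a) 1).
  elim: (hs a) => [y ys|||].
  - by apply: Gen_mem; rewrite mem_cat (map_f (fun a => elt (base_delta 1 a) 1)).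
  - by rewrite base_delta1; apply: Gen_one.
  - move=> y z _ hy _ hz.
    have -> : elt (base_delta 1 (y * z)) 1 = elt (base_delta 1 y) 1 * elt (base_delta 1 z) 1.
      by rewrite wreathM /= base_act1 -base_deltaM mulg1.
    exact: Gen_mul.
  - move=> y _ hy.
    have -> : elt (base_delta 1 y^-1) 1 = (elt (base_delta 1 y) 1)^-1.
      apply/esym/mulg1_eq; rewrite wreathM /= base_act1 -base_deltaM mulgV mulg1.
      by rewrite base_delta1.
    exact: Gen_inv.
have gen_delta x a : generated S (elt (base_delta x a) 1).
  rewrite -[x]mulg1 -base_act_delta -wreath_conj.
  by apply: Gen_mul; [apply: Gen_mul|apply: Gen_inv].
have gen_base : generated S (elt f 1).
  elim: {f}#|` finsupp f| {-2}f (leqnn #|` finsupp f|) => [|n IH] f.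
    rewrite leqn0 cardfs_eq0 => /eqP f0.
    have -> : f = [fsfun].
      by apply/fsfunP => x; rewrite fsfun0E fsfun_dflt // f0.
    exact: Gen_one.
  have [f0|[x xf]] := fset_0Vmem (finsupp f);
    first by rewrite f0 cardfs0 => _; apply: IH; rewrite f0 cardfs0.
  move=> fn; have -> : elt f 1 = elt (base_delta x (f x)) 1 * elt [fsfun f with x |-> 1] 1.
    rewrite wreathM /= base_act1 mulg1; congr pair; apply/fsfunP => y.
    rewrite base_mulE base_deltaE fsfun_withE.
    by case: eqP => [->|]; rewrite ?mulg1 ?mul1g.
  apply: Gen_mul; first exact: gen_delta.
  apply: IH; rewrite finsupp_with eqxx.
  by move: fn; rewrite (cardfsD1 x) xf.
have := Gen_mul gen_base (genB b).
by rewrite wreathM /= base_act_one base_mul1 mul1g.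
Qed.

End WreathTheory.
(** * Central extensions from cocycles *)

Section CocycleExtension.
Local Open Scope group_scope.
Variables (A : zmodType) (Q : groupType).

(** Normalised 2-cocycle of [Q] with values in the trivial module [A]. *)
Definition cocycle (c : Q -> Q -> A) : Prop :=
  [/\ forall u, c 1 u = 0%R, forall u, c u 1 = 0%R
    & forall u v w, (c u v + c (u * v)%g w = c v w + c u (v * w)%g)%R].

Variables (c : Q -> Q -> A) (hc : cocycle c).

Definition cocycle_ext (_ : cocycle c) : Type := (A * Q)%type.
Local Notation E := (cocycle_ext hc).
Implicit Types (x y z : E).

Definition cocycle_mul x y : E := ((x.1 + y.1 + c x.2 y.2)%R, x.2 * y.2).
Definition cocycle_one : E := (0%R, 1).
Definition cocycle_inv x : E := ((- x.1 - c x.2 x.2^-1%g)%R, x.2^-1).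

Lemma cocycle_mulA : associative cocycle_mul.
Proof.
have [_ _ cA] := hc; move=> x y z; congr pair; last exact: mulgA.
rewrite /=; transitivity (x.1 + y.1 + z.1 + (c y.2 z.2 + c x.2 (y.2 * z.2)%g))%R.
  by rewrite !addrA.
by rewrite -cA !addrA -!(addrAC _ z.1).
Qed.

Lemma cocycle_mul1 : left_id cocycle_one cocycle_mul.
Proof.
have [c1 _ _] := hc; move=> [a u]; congr pair; last exact: mul1g.
by rewrite /= c1 add0r addr0.
Qed.

Lemma cocycle_mulr1 : right_id cocycle_one cocycle_mul.
Proof.
have [_ c1 _] := hc; move=> [a u]; congr pair; last exact: mulg1.
by rewrite /= c1 !addr0.
Qed.

(** The cocycle identity at [u], [u^-1], [u]; it makes the right inverse a left
    one. *)
Lemma cocycleV u : c u^-1 u = c u u^-1.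
Proof.
have [c1 c1r cA] := hc; have := cA u u^-1 u.
by rewrite mulgV mulVg c1 c1r !addr0.
Qed.

Lemma cocycle_mulV : left_inverse cocycle_one cocycle_inv cocycle_mul.
Proof.
move=> [a u]; congr pair; last exact: mulVg.
by rewrite /= cocycleV addrAC addrNK addNr.
Qed.

Lemma cocycle_mulrV : right_inverse cocycle_one cocycle_inv cocycle_mul.
Proof.
move=> [a u]; congr pair; last exact: mulgV.
by rewrite /= addrA addrNK subrr.
Qed.

HB.instance Definition _ := Choice.on E.
HB.instance Definition _ := isGroup.Build E
  cocycle_mulA cocycle_mul1 cocycle_mulr1 cocycle_mulV cocycle_mulrV.

Lemma cocycle_extM x y : x * y = cocycle_mul x y.
Proof. by []. Qed.

Definition cocycle_proj (x : E) : Q := x.2.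
Definition cocycle_incl (a : Algebra.to_multiplicative A) : E := (a, 1).

Fact cocycle_proj_morph : {morph cocycle_proj : x y / x * y}.
Proof. by []. Qed.
HB.instance Definition _ := isMultiplicative.Build E Q cocycle_proj cocycle_proj_morph.
HB.instance Definition _ :=
  Multiplicative_isUMagmaMorphism.Build E Q cocycle_proj (erefl _).

Fact cocycle_incl_morph : {morph cocycle_incl : x y / x * y}.
Proof.
have [c1 _ _] := hc; move=> a b; rewrite cocycle_extM /cocycle_mul /= c1 addr0 mulg1 //.
Qed.
HB.instance Definition _ :=
  isMultiplicative.Build (Algebra.to_multiplicative A) E cocycle_incl cocycle_incl_morph.
HB.instance Definition _ :=
  Multiplicative_isUMagmaMorphism.Build (Algebra.to_multiplicative A) E cocycle_incl
    (erefl _).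

Lemma cocycle_extP : central_extension (Algebra.to_multiplicative A) E Q.
Proof.
have [c1 c1r _] := hc.
exists (cocycle_incl : group_hom _ _), (cocycle_proj : group_hom _ _); split.
- by move=> a b [].
- move=> [a u]; split=> [/= ->|[b [_ <-]] //]; by exists a.
- by move=> q; exists (0%R, q).
- move=> a [b u]; rewrite /commute !cocycle_extM /cocycle_mul /= c1 c1r !addr0.
  by rewrite mulg1 mul1g addrC.
Qed.

End CocycleExtension.

(** * The extensions of the wreath product *)

Definition lamps : groupType := wreath Zsq_grp Zgrp.
Definition lamp_base : Type := {fsfun Zgrp -> Zsq_grp with 1%g}.

Section Form.
Local Open Scope ring_scope.
Implicit Types (f g h : lamp_base).

Definition coord1 (v : Zsq_grp) : 'Z_2 := (v.1 : int)%:~R.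
Definition coord2 (v : Zsq_grp) : 'Z_2 := (v.2 : int)%:~R.

Lemma coord1M v w : coord1 (v * w)%g = coord1 v + coord1 w.
Proof. by rewrite /coord1 -intrD. Qed.

Lemma coord2M v w : coord2 (v * w)%g = coord2 v + coord2 w.
Proof. by rewrite /coord2 -intrD. Qed.

Lemma coord1_dflt f i : i \notin finsupp f -> coord1 (f i) = 0.
Proof. by move=> /fsfun_dflt->. Qed.

Lemma coord2_dflt f j : j \notin finsupp f -> coord2 (f j) = 0.
Proof. by move=> /fsfun_dflt->. Qed.

(** The shift-invariant bilinear form whose value on the second generator of the
    [j]-th lamp and the first generator of the [i]-th lamp is [phi (j - i)].  Used
    as a cocycle, it makes its antisymmetrisation the commutator form of the
    extension. *)
Definition form phi f g : 'Z_2 :=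
  \sum_(j <- finsupp f) \sum_(i <- finsupp g)
    coord2 (f j) * coord1 (g i) * (phi ((j : int) - (i : int)))%:R.

Lemma sum_fset_support (V : nmodType) (S S' : {fset Zgrp}) (F : Zgrp -> V) :
  (forall i, i \notin S -> F i = 0) -> (forall i, i \notin S' -> F i = 0) ->
  \sum_(i <- S) F i = \sum_(i <- S') F i.
Proof.
move=> FS FS'; rewrite (big_fset_incl _ (fsubsetUl S S')); last by move=> i _ /FS.
by symmetry; apply: big_fset_incl (fsubsetUr S S') _ => i _ /FS'.
Qed.

Lemma formE (S T : {fset Zgrp}) phi f g :
  (forall j, j \notin S -> coord2 (f j) = 0) ->
  (forall i, i \notin T -> coord1 (g i) = 0) ->
  form phi f g = \sum_(j <- S) \sum_(i <- T)
    coord2 (f j) * coord1 (g i) * (phi ((j : int) - (i : int)))%:R.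
Proof.
move=> fS gT; transitivity (\sum_(j <- S) \sum_(i <- finsupp g)
    coord2 (f j) * coord1 (g i) * (phi ((j : int) - (i : int)))%:R).
  by apply: sum_fset_support => j; [move=> /coord2_dflt->|move=> /fS->];
     rewrite big1_seq // => i _; rewrite !mul0r.
apply: eq_bigr => j _; apply: sum_fset_support => i.
  by move=> /coord1_dflt->; rewrite mulr0 mul0r.
by move=> /gT->; rewrite mulr0 mul0r.
Qed.

Lemma formDl phi f g h : form phi (base_mul f g) h = form phi f h + form phi g h.
Proof.
pose S := (finsupp f `|` finsupp g)%fset.
have fS j : j \notin S -> coord2 (f j) = 0.
  by rewrite in_fsetU negb_or => /andP[/coord2_dflt].
have gS j : j \notin S -> coord2 (g j) = 0.
  by rewrite in_fsetU negb_or => /andP[_ /coord2_dflt].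
have fgS j : j \notin S -> coord2 (base_mul f g j) = 0.
  by move=> jS; rewrite base_mulE coord2M fS // gS // addr0.
rewrite (formE _ fgS (@coord1_dflt h)) (formE _ fS (@coord1_dflt h)).
rewrite (formE _ gS (@coord1_dflt h)) -big_split; apply: eq_bigr => j _.
rewrite -big_split; apply: eq_bigr => i _ /=.
by rewrite base_mulE coord2M !mulrDl.
Qed.

Lemma formDr phi f g h : form phi f (base_mul g h) = form phi f g + form phi f h.
Proof.
pose T := (finsupp g `|` finsupp h)%fset.
have gT i : i \notin T -> coord1 (g i) = 0.
  by rewrite in_fsetU negb_or => /andP[/coord1_dflt].
have hT i : i \notin T -> coord1 (h i) = 0.
  by rewrite in_fsetU negb_or => /andP[_ /coord1_dflt].
have ghT i : i \notin T -> coord1 (base_mul g h i) = 0.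
  by move=> iT; rewrite base_mulE coord1M gT // hT // addr0.
rewrite (formE _ (@coord2_dflt f) ghT) (formE _ (@coord2_dflt f) gT).
rewrite (formE _ (@coord2_dflt f) hT) -big_split; apply: eq_bigr => j _.
rewrite -big_split; apply: eq_bigr => i _ /=.
by rewrite base_mulE coord1M mulrDr mulrDl.
Qed.

Lemma form0l phi f : form phi [fsfun] f = 0.
Proof. by rewrite /form finsupp0 big_seq_fset0. Qed.

Lemma form0r phi f : form phi f [fsfun] = 0.
Proof. by rewrite /form finsupp0 big1_seq // => j _; rewrite big_seq_fset0. Qed.

Lemma form_act phi (k : Zgrp) f g : form phi (base_act k f) (base_act k g) = form phi f g.
Proof.
rewrite /form !finsupp_base_act big_imfset /=; last by move=> i j _ _ /mulgI.
apply: eq_bigr => j _; rewrite big_imfset /=; last by move=> i i' _ _ /mulgI.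
apply: eq_bigr => i _; rewrite !base_actE !mulKg; congr (_ * (nat_of_bool (phi _))%:R).
have shift_sub (x y z : int) : (z + x) - (z + y) = x - y by ring.
exact: shift_sub.
Qed.

(** Only the second coordinates move: the differences of positions paired by the
    form then change by [d], whence [form_shift]. *)
Definition translate (d : int) f : lamp_base :=
  [fsfun x in (finsupp f `|` [fset ((y : int) - d : Zgrp) | y in finsupp f])%fset =>
     ((f x).1, (f ((x : int) + d)).2) : Zsq_grp].

Lemma translateE d f (x : Zgrp) :
  translate d f x = ((f x).1, (f ((x : int) + d)).2).
Proof.
rewrite fsfun_fun; case: ifPn => //.
rewrite in_fsetU negb_or => /andP[/fsfun_dflt-> xdf].
rewrite (@fsfun_dflt _ _ _ f ((x : int) + d)) //.
apply: contra xdf => xdf; apply/imfsetP; exists ((x : int) + d) => //=.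
by rewrite addrK.
Qed.

Lemma translateK d : cancel (translate d) (translate (- d)).
Proof.
move=> f; apply/fsfunP => x; rewrite !translateE /=.
by rewrite addrNK -surjective_pairing.
Qed.

Lemma translateKV d : cancel (translate (- d)) (translate d).
Proof. by move=> f; rewrite -{1}[d]opprK translateK. Qed.

Lemma translate_mul d f g :
  translate d (base_mul f g) = base_mul (translate d f) (translate d g).
Proof. by apply/fsfunP => x; rewrite !(base_mulE, translateE). Qed.

Lemma translate_act d (k : Zgrp) f :
  translate d (base_act k f) = base_act k (translate d f).
Proof.
apply/fsfunP => x; rewrite !(base_actE, translateE).
by congr (_, (f _).2); apply: (addrA (- (k : int)) x d).
Qed.

Lemma form_shift d phi f g :
  form (shift d phi) (translate d f) (translate d g) = form phi f g.
Proof.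
pose S := [fset ((y : int) - d : Zgrp) | y in finsupp f]%fset.
have fS j : j \notin S -> coord2 (translate d f j) = 0.
  move=> jS; rewrite translateE -[LHS]/(coord2 (f ((j : int) + d))).
  apply: coord2_dflt; apply: contra jS => jS; apply/imfsetP.
  by exists ((j : int) + d) => //=; rewrite addrK.
have gT i : i \notin finsupp g -> coord1 (translate d g i) = 0.
  by move=> ig; rewrite translateE -[LHS]/(coord1 (g i)) coord1_dflt.
rewrite (formE _ fS gT) big_imfset /=; last by move=> i j _ _ /addIr.
apply: eq_bigr => j _; apply: eq_bigr => i _; rewrite !translateE /shift addrNK.
congr (_ * (nat_of_bool (phi _))%:R).
by have sub_shift (x y z : int) : x - z - y + z = x - y by [ring]; apply: sub_shift.
Qed.

End Form.
Section Extensions.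
Local Open Scope group_scope.

Definition form_cocycle phi (u v : lamps) : 'Z_2 := form phi u.1 (base_act u.2 v.1).

Lemma form_cocycleP phi : cocycle (form_cocycle phi).
Proof.
split=> [u|u|u v w]; rewrite /form_cocycle.
- by rewrite form0l.
- by rewrite /= base_act_one form0r.
- by rewrite /= formDl base_act_mul formDr base_actM form_act addrA [RHS]addrC.
Qed.

Definition ext phi : groupType := cocycle_ext (form_cocycleP phi).

(** The common underlying set of the groups [ext phi]. *)
Definition carrier : Type := ('Z_2 * lamps)%type.

Lemma ext_central phi : central_extension Zmod2_grp (ext phi) (wreath Zsq_grp Zgrp).
Proof. exact: cocycle_extP. Qed.

Lemma fg_ext phi : finitely_generated (ext phi).
Proof.
apply: fg_central_extension (ext_central phi).
- by apply: (@fg_finite Zmod2_grp (enum 'Z_2)) => x; rewrite mem_enum.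
- by apply: fg_wreath; [apply: fg_prod|]; exact: fg_Zgrp.
Qed.

Definition lamp1 : carrier :=
  (0%R, (base_delta (0%R : Zgrp) ((1%R, 0%R) : Zsq_grp), 0%R : Zgrp)).
Definition lamp2 : carrier :=
  (0%R, (base_delta (0%R : Zgrp) ((0%R, 1%R) : Zsq_grp), 0%R : Zgrp)).
Definition walk : carrier := (0%R, ([fsfun], 1%R : Zgrp)).

(** The test from which [phi] is recovered.  It is made for arbitrary triples
    because an isomorphism may send the three generators anywhere. *)
Definition commutes phi (x y t : carrier) n : bool :=
  `[< @commute (ext phi) x ((t : ext phi) ^+ n * (y : ext phi) * (t : ext phi) ^- n) >].

(** The commutator of the two lamps at distance [n] is [phi n], so [phi] can
    be read off from the triple [(lamp1, lamp2, walk)]. *)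
Lemma commutes_lamps phi n : commutes phi lamp1 lamp2 walk n = ~~ phi (Posz n).
Proof.
pose b : lamps := (base_delta (0%R : Zgrp) ((0%R, 1%R) : Zsq_grp), 1).
pose t : lamps := ([fsfun], 1%R : Zgrp).
rewrite /commutes; set y := (X in commute _ X).
have walkX m : t ^+ m = ([fsfun], Posz m : Zgrp).
  elim: m => // m IH; rewrite expgSr IH wreathM /= base_act_one base_mul1.
  by congr pair; rewrite -[m.+1]addn1 PoszD.
have y2 : y.2 = (base_delta (Posz n : Zgrp) ((0%R, 1%R) : Zsq_grp), 1).
  have walkX2 : ((walk : ext phi) ^+ n).2 = t ^+ n.
    exact: (gmulfXn (cocycle_proj (hc := form_cocycleP phi) : group_hom _ _)).
  transitivity (t ^+ n * b * (t ^+ n)^-1); first by rewrite -walkX2.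
  rewrite walkX wreath_conj base_act_delta; congr pair.
  by apply: (congr1 (fun k : Zgrp => base_delta k _)); apply: addr0.
have finsupp_delta k (v : Zsq_grp) : v != 1 -> finsupp (base_delta k v) = [fset k]%fset.
  by move=> /negPf vN1; rewrite finsupp_with vN1 finsupp0 fsetU0.
have form12 : form_cocycle phi lamp1.2 y.2 = 0%R.
  rewrite y2 /form_cocycle base_act1 /form !finsupp_delta // !big_seq_fset1 /=.
  by rewrite !base_deltaE !eqxx /coord2 /= mulr0z !mul0r.
have form21 : form_cocycle phi y.2 lamp1.2 = (phi (Posz n))%:R%R.
  rewrite y2 /form_cocycle base_act1 /form !finsupp_delta // !big_seq_fset1 /=.
  by rewrite !base_deltaE !eqxx /coord2 /coord1 /= !mul1r subr0.
have lampsC : lamp1.2 * y.2 = y.2 * lamp1.2.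
  rewrite y2 !wreathM /= !base_act1; congr pair; apply/fsfunP => k.
  by rewrite !base_mulE; congr pair; apply: addrC.
have mul1E : ((lamp1 : ext phi) * y).1 = y.1.
  transitivity (0 + y.1 + form_cocycle phi lamp1.2 y.2)%R; first by [].
  by rewrite form12 addr0 add0r.
have mul2E : (y * (lamp1 : ext phi)).1 = (y.1 + (phi (Posz n))%:R)%R.
  transitivity (y.1 + 0 + form_cocycle phi y.2 lamp1.2)%R; first by [].
  by rewrite form21 addr0.
apply/asboolP/idP => [/(congr1 fst)|].
  rewrite mul1E mul2E -[LHS]addr0 => /addrI.
  by case: (phi (Posz n)).
move=> /negPf phin; rewrite /commute [LHS]surjective_pairing [RHS]surjective_pairing.
by congr pair => //; rewrite mul1E mul2E phin addr0.
Qed.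

(** An isomorphism carries the generating triple of [ext phi] to a triple from
    which [phi] is read off in [ext psi]: as there are countably many triples,
    each isomorphism class contains only countably many of the groups. *)
Lemma isomorphic_commutes phi psi :
  isomorphic (ext phi) (ext psi) ->
  exists x y t, forall n, phi (Posz n) = ~~ commutes psi x y t n.
Proof.
move=> [f fbij]; exists (f lamp1), (f lamp2), (f walk) => n.
rewrite -[LHS]negbK -commutes_lamps; congr (~~ _).
rewrite /commutes -gmulfXn -gmulfV -!gmulfM.
apply/asbool_equiv_eq; rewrite /commute -!gmulfM; split=> [->//|].
exact: (bij_inj fbij).
Qed.

(** The effect of replacing the second generator [lamp2] by its conjugate by a
    power of [walk], which moves all the differences of positions by [d]. *)
Definition translate_ext d phi (x : ext phi) : ext (shift d phi) :=
  (x.1, (translate d x.2.1, x.2.2)).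

Fact translate_ext_morph d phi : {morph @translate_ext d phi : x y / x * y}.
Proof.
move=> x y; congr pair; last by rewrite [LHS]/= translate_mul translate_act.
by rewrite /= /form_cocycle /= -translate_act form_shift.
Qed.

Fact translate_ext1 d phi : @translate_ext d phi 1 = 1.
Proof.
congr pair; congr pair; apply/fsfunP => x.
by rewrite translateE !fsfun0E.
Qed.

HB.instance Definition _ d phi :=
  isMultiplicative.Build (ext phi) (ext (shift d phi)) _ (@translate_ext_morph d phi).
HB.instance Definition _ d phi :=
  Multiplicative_isUMagmaMorphism.Build (ext phi) (ext (shift d phi)) _
    (@translate_ext1 d phi).

Lemma isomorphic_shift d phi : isomorphic (ext phi) (ext (shift d phi)).
Proof.
exists (@translate_ext d phi : group_hom _ _).
exists (fun x => (x.1, (translate (- d)%R x.2.1, x.2.2))) => -[a [f m]].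
  by congr (_, (_, _)); apply: translateK.
by congr (_, (_, _)); apply: translateKV.
Qed.

End Extensions.
(** * Locally constant dependence on the parameter *)

Definition locally_constant (V : Type) (F : cantor -> V) : Prop :=
  forall phi, exists n, forall psi, agree n phi psi -> F psi = F phi.

Lemma locally_constant_cst (V : Type) (v : V) : locally_constant (fun=> v).
Proof. by move=> phi; exists 0%N. Qed.

Lemma locally_constant_apply (U V : Type) (h : cantor -> U -> V) (F : cantor -> U) :
  (forall u, locally_constant (h^~ u)) -> locally_constant F ->
  locally_constant (fun phi => h phi (F phi)).
Proof.
move=> hh hF phi; have [n hn] := hF phi; have [m hm] := hh (F phi) phi.
exists (maxn n m) => psi agr; rewrite hn; last first.
  by apply: agree_le agr; apply: leq_maxl.
by apply: hm; apply: agree_le agr; apply: leq_maxr.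
Qed.

Lemma locally_constant_map (U V : Type) (h : U -> V) (F : cantor -> U) :
  locally_constant F -> locally_constant (fun phi => h (F phi)).
Proof.
by apply: (locally_constant_apply (h := fun=> h)) => u; apply: locally_constant_cst.
Qed.

Lemma locally_constant_map2 (U V W : Type) (h : U -> V -> W) F G :
  locally_constant F -> locally_constant G ->
  locally_constant (fun phi => h (F phi) (G phi)).
Proof.
move=> hF; apply: (locally_constant_apply (h := fun phi v => h (F phi) v)) => v.
exact: (locally_constant_map (h^~ v)).
Qed.

Lemma locally_constant_coord (k : int) : locally_constant (fun phi => phi k).
Proof. by move=> phi; exists `|k|%N => psi ->. Qed.

Lemma locally_constant_sum (V : nmodType) (I : Type) (r : seq I) (F : I -> cantor -> V) :
  (forall i, locally_constant (F i)) ->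
  locally_constant (fun phi => \sum_(i <- r) F i phi)%R.
Proof.
move=> hF; elim: r => [|i r IH].
  under eq_fun do rewrite big_nil; exact: locally_constant_cst.
under eq_fun do rewrite big_cons.
exact: (locally_constant_map2 +%R).
Qed.

Lemma locally_constant_form f g : locally_constant (fun phi => form phi f g).
Proof.
apply: locally_constant_sum => j; apply: locally_constant_sum => i.
exact: (locally_constant_map (fun b : bool => coord2 (f j) * coord1 (g i) * b%:R)%R
  (locally_constant_coord ((j : int) - (i : int))%R)).
Qed.

Section LocallyConstantExt.
Local Open Scope group_scope.

Lemma locally_constant_extM (F G : cantor -> carrier) :
  locally_constant F -> locally_constant G ->
  locally_constant (fun phi => (F phi : ext phi) * (G phi : ext phi) : carrier).
Proof.
move=> hF hG.
apply: (locally_constant_apply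
  (h := fun phi (p : carrier * carrier) => (p.1 : ext phi) * (p.2 : ext phi) : carrier)
  (F := fun phi => (F phi, G phi))); last exact: locally_constant_map2.
move=> [[a u] [b v]].
exact: (locally_constant_map (fun c : 'Z_2 => ((a + b + c)%R, u * v) : carrier)
  (locally_constant_form _ _)).
Qed.

Lemma locally_constant_extV (F : cantor -> carrier) :
  locally_constant F -> locally_constant (fun phi => (F phi : ext phi)^-1 : carrier).
Proof.
apply: (locally_constant_apply (h := fun phi (x : carrier) => (x : ext phi)^-1 : carrier)).
move=> [a u].
exact: (locally_constant_map (fun c : 'Z_2 => ((- a - c)%R, u^-1) : carrier)
  (locally_constant_form _ _)).
Qed.

Lemma locally_constant_extX (F : cantor -> carrier) n :
  locally_constant F -> locally_constant (fun phi => (F phi : ext phi) ^+ n : carrier).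
Proof.
move=> hF; elim: n => [|n IH]; first exact: locally_constant_cst.
under eq_fun do rewrite expgSr.
exact: locally_constant_extM.
Qed.

Lemma locally_constant_commutes x y t n :
  locally_constant (fun phi => commutes phi x y t n).
Proof.
pose z phi : carrier := (t : ext phi) ^+ n * (y : ext phi) * (t : ext phi) ^- n.
have hz : locally_constant z.
  have ht : locally_constant (fun phi => (t : ext phi) ^+ n : carrier).
    exact: (locally_constant_extX _ (locally_constant_cst t)).
  apply: (locally_constant_extM _ (locally_constant_extV ht)).
  exact: (locally_constant_extM ht (locally_constant_cst y)).
exact: (locally_constant_map2 (fun u v : carrier => `[< u = v >])
  (locally_constant_extM (locally_constant_cst x) hz)
  (locally_constant_extM hz (locally_constant_cst x))).
Qed.

Lemma locally_constant_eval (e : nat -> carrier) (t : term) :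
  locally_constant (fun phi => @eval (ext phi) e t : carrier).
Proof.
elim: t => [k||t1 h1 t2 h2|t1 h1] /=; try exact: locally_constant_cst.
- exact: locally_constant_extM.
- exact: locally_constant_extV.
Qed.

End LocallyConstantExt.

(** Values of [psi] on a window decide whether [x] commutes with the [n]-th
    conjugate in [ext psi], while [phi n] can still be chosen if [n] lies outside
    the window on which [phi] is prescribed. *)
Lemma dense_interior_commutes x y t :
  dense_interior2 (fun phi psi => exists n, phi (Posz n) = commutes psi x y t n).
Proof.
move=> phi psi n; have [m hm] := locally_constant_commutes x y t n.+1 psi.
pose phi' : cantor := fun k =>
  if k == Posz n.+1 then commutes psi x y t n.+1 else phi k.
exists phi', psi, (maxn n.+1 m); split=> //.
- by apply: leq_trans (leq_maxl _ _).
- by move=> k kn; rewrite /phi' ifF //; lia.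
- move=> chi chi' h h'; exists n.+1.
  rewrite (hm chi'); last by apply: agree_le h'; apply: leq_maxr.
  by rewrite -(h (Posz n.+1)) ?leq_maxl // /phi' eqxx.
Qed.

(** * Truth of first-order formulas *)

Lemma eq_eval (G : groupType) (t : term) (e e' : nat -> G) :
  {in term_vars t, e =1 e'} -> eval e t = eval e' t.
Proof.
elim: t => [k||t1 h1 t2 h2|t1 h1] /= ee'.
- by apply: ee'; rewrite mem_head.
- by [].
- by rewrite h1 ?h2 // => k kt; apply: ee'; rewrite mem_cat kt ?orbT.
- by rewrite h1.
Qed.

Lemma eq_holds (G : groupType) (theta : formula) (e e' : nat -> G) :
  {in free_vars theta, e =1 e'} -> (holds e theta <-> holds e' theta).
Proof.
have upd k (phi1 : formula) (u u' : nat -> G) (x : G) :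
    {in [seq j <- free_vars phi1 | j != k], u =1 u'} ->
    {in free_vars phi1, [eta u with k |-> x] =1 [eta u' with k |-> x]}.
  move=> uu' j jphi /=; case: eqP => // /eqP jk.
  by apply: uu'; rewrite mem_filter jk.
elim: theta e e' => [t1 t2|p IH|p IHp q IHq|p IHp q IHq|p IHp q IHq|k p IH|k p IH]
  e e' /= ee'.
- by rewrite (@eq_eval _ t1 e e') ?(@eq_eval _ t2 e e') // => k kt; apply: ee';
    rewrite mem_cat kt ?orbT.
- by rewrite (IH e e' ee').
- by rewrite (IHp e e') ?(IHq e e') // => k kt; apply: ee'; rewrite mem_cat kt ?orbT.
- by rewrite (IHp e e') ?(IHq e e') // => k kt; apply: ee'; rewrite mem_cat kt ?orbT.
- by rewrite (IHp e e') ?(IHq e e') // => k kt; apply: ee'; rewrite mem_cat kt ?orbT.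
- by split=> h x; have /IH := upd k p e e' x ee'; [move=> <-|move=> ->].
- by split=> -[x hx]; exists x; have /IH := upd k p e e' x ee'; [move=> <-|move=> ->].
Qed.

Lemma eval_hom (G H : groupType) (f : group_hom G H) (e : nat -> G) t :
  eval (f \o e) t = f (eval e t).
Proof.
elim: t => [k||t1 h1 t2 h2|t1 h1] //=.
- by rewrite gmulf1.
- by rewrite gmulfM h1 h2.
- by rewrite gmulfV h1.
Qed.

Lemma holds_isomorphism (G H : groupType) (f : group_hom G H) (theta : formula) e :
  bijective f -> holds (f \o e) theta <-> holds e theta.
Proof.
move=> fbij; have finj := bij_inj fbij; case: fbij => f' fK f'K.
have upd (u : nat -> G) k x : f \o [eta u with k |-> x] = [eta f \o u with k |-> f x].
  by apply: funext => j /=; case: eqP.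
elim: theta e => [t1 t2|p IH|p IHp q IHq|p IHp q IHq|p IHp q IHq|k p IH|k p IH] e /=.
- by rewrite !eval_hom; split=> [/finj|->].
- by rewrite IH.
- by rewrite IHp IHq.
- by rewrite IHp IHq.
- by rewrite IHp IHq.
- split=> h x; first by apply/IH; rewrite upd.
  by rewrite -[x]f'K -upd; apply/IH.
- split=> -[x hx]; last by exists (f x); rewrite -upd; apply/IH.
  by exists (f' x); apply/IH; rewrite upd f'K.
Qed.

Fixpoint term_code (t : term) : GenTree.tree nat :=
  match t with
  | Var k => GenTree.Leaf k
  | One => GenTree.Node 0 [::]
  | Mul t1 t2 => GenTree.Node 1 [:: term_code t1; term_code t2]
  | Inv t1 => GenTree.Node 2 [:: term_code t1]
  end.

Fixpoint formula_code (theta : formula) : GenTree.tree nat :=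
  match theta with
  | Equal t1 t2 => GenTree.Node 0 [:: term_code t1; term_code t2]
  | Not p => GenTree.Node 1 [:: formula_code p]
  | And p q => GenTree.Node 2 [:: formula_code p; formula_code q]
  | Or p q => GenTree.Node 3 [:: formula_code p; formula_code q]
  | Defs.Implies p q => GenTree.Node 4 [:: formula_code p; formula_code q]
  | Forall k p => GenTree.Node 5 [:: GenTree.Leaf k; formula_code p]
  | Exists k p => GenTree.Node 6 [:: GenTree.Leaf k; formula_code p]
  end.

Lemma term_code_inj : injective term_code.
Proof.
elim=> [k||t1 h1 t2 h2|t1 h1] [j||u1 u2|u1] //=.
- by case=> ->.
- by case=> /h1-> /h2->.
- by case=> /h1->.
Qed.

Lemma formula_code_inj : injective formula_code.
Proof.
elim=> [t1 t2|p IH|p IHp q IHq|p IHp q IHq|p IHp q IHq|k p IH|k p IH]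
  [u1 u2|r|r s|r s|r s|j r|j r] //= [].
- by move=> /term_code_inj-> /term_code_inj->.
- by move=> /IH->.
- by move=> /IHp-> /IHq->.
- by move=> /IHp-> /IHq->.
- by move=> /IHp-> /IHq->.
- by move=> -> /IH->.
- by move=> -> /IH->.
Qed.

(** The type being coded is [carrier] written additively, which is convertible to
    it. *)
Definition carrier_code : carrier -> nat :=
  @choice.pickle ('Z_2 * ({fsfun int -> int * int with (0, 0)%R} * int))%type.

Lemma carrier_code_inj : injective carrier_code.
Proof. exact: pcan_inj choice.pickleK. Qed.

(** Quantifiers over the group are countable unions and intersections, since all
    the groups have the same countable underlying set. *)
Lemma baire_holds (theta : formula) (e : nat -> carrier) :
  baire (fun phi => @holds (ext phi) e theta).
Proof.
have baireI A A' : baire A -> baire A' -> baire (fun phi => A phi /\ A' phi).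
  move=> bA bA'; have bb (b : bool) : baire (if b then A else A') by case: b.
  have b_inj : injective nat_of_bool by do 2 case.
  apply: baire_iff (baire_bigcap b_inj bb) => phi.
  by split=> [h|[? ?] []//]; split; [apply: (h true)|apply: (h false)].
elim: theta e => [t1 t2|p IH|p IHp q IHq|p IHp q IHq|p IHp q IHq|k p IH|k p IH] e /=.
- apply: baire_clopen => phi.
  have [n hn] := locally_constant_map2 pair (locally_constant_eval e t1)
    (locally_constant_eval e t2) phi.
  by exists n => psi /hn[-> ->].
- exact: baire_compl.
- exact: baireI.
- apply: baire_iff (baire_compl (baireI _ _ (baire_compl (IHp e)) (baire_compl (IHq e)))).
  by move=> phi; split=> [/not_andP[]/contrapT|]; tauto.
- apply: baire_iff (baire_compl (baireI _ _ (IHp e) (baire_compl (IHq e)))).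
  by move=> phi; split=> [h hp|h [/h]//]; apply: contrapT => hq; apply: h.
- exact: (baire_bigcap carrier_code_inj (fun x => IH [eta e with k |-> x])).
- apply: baire_iff (baire_compl (baire_bigcap carrier_code_inj
    (fun x => baire_compl (IH [eta e with k |-> x])))) => phi.
  by split=> [/existsNP[x /contrapT hx]|[x hx] /(_ x)]; [exists x|].
Qed.

(** Isomorphisms preserve the valuation constantly equal to 1, so this notion is
    invariant under isomorphism even when [theta] has free variables. *)
Definition truth phi (theta : formula) : Prop := @holds (ext phi) (fun=> 1%g) theta.

Lemma satisfies_truth phi (theta : formula) :
  sentence theta -> (satisfies (ext phi) theta <-> truth phi theta).
Proof.
move=> closed; split=> [h|h e]; first exact: h.
have <- // : @holds (ext phi) (fun=> 1%g) theta <-> holds e theta.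
by apply: eq_holds => k; rewrite closed.
Qed.

(** Shifting [phi] does not change the isomorphism type of [ext phi], so the set
    of those [phi] for which [theta] is true is shift-invariant. *)
Lemma truth_zero_one (theta : formula) :
  comeager (fun phi => truth phi theta) \/ comeager (fun phi => ~ truth phi theta).
Proof.
apply: zero_one_law (baire_holds theta (fun=> (0%R, 1%g))) => d phi.
have [f fbij] := isomorphic_shift d phi.
have f1 : f \o (fun _ : nat => 1%g : ext phi) = (fun=> 1%g).
  by apply: funext => k /=; rewrite gmulf1.
by move=> h; have /(holds_isomorphism theta _ fbij) := h; rewrite f1.
Qed.

(** There are countably many formulas, so a generic [phi] gives to all of them
    their generic truth values. *)
Lemma comeager_elementarily_equivalent : exists2 K : cantor -> Prop, comeager K
  & forall phi psi, K phi -> K psi -> elementarily_equivalent (ext phi) (ext psi).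
Proof.
pose K phi := forall theta, truth phi theta <-> comeager (fun psi => truth psi theta).
exists K; last first.
  move=> phi psi Kphi Kpsi theta closed.
  by rewrite !satisfies_truth // Kphi Kpsi.
have code_inj : injective (choice.pickle \o formula_code).
  by apply: inj_comp formula_code_inj; apply: pcan_inj choice.pickleK.
apply: (comeager_bigcap code_inj) => theta.
have [c|nc] := EM (comeager (fun psi => truth psi theta)).
  by apply: comeager_le (c) => phi h; split.
have [//|c] := truth_zero_one theta.
by apply: comeager_le (c) => phi h; split.
Qed.

Theorem corollary1p8 :
  exists G : (nat -> bool) -> groupType,
    [/\ forall s, finitely_generated (G s),
        forall s t, s <> t -> ~ isomorphic (G s) (G t),
        forall s t, elementarily_equivalent (G s) (G t)
      & forall s, central_extension Zmod2_grp (G s) (wreath Zsq_grp Zgrp)].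
Proof.
have [K [D dD DK] Kequiv] := comeager_elementarily_equivalent.
(* [E j] is vacuous unless [j] encodes a triple of elements. *)
pose E j phi psi := forall x y t,
  j = choice.pickle (carrier_code x, carrier_code y, carrier_code t) ->
  exists n, phi (Posz n) = commutes psi x y t n.
have dE j : dense_interior2 (E j).
  have [[x [y [t jE]]]|none] := EM (exists x y t,
      j = choice.pickle (carrier_code x, carrier_code y, carrier_code t)).
    move=> phi psi n; have [phi' [psi' [m [nm h h' hm]]]] :=
      dense_interior_commutes x y t phi psi n.
    exists phi', psi', m; split=> // chi chi' c c' x' y' t'.
    rewrite jE => /(pcan_inj choice.pickleK)[].
    by move=> /carrier_code_inj<- /carrier_code_inj<- /carrier_code_inj<-; apply: hm.
  move=> phi psi n; exists phi, psi, n; split=> // chi chi' _ _ x y t jE.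
  by case: none; exists x, y, t.
have [F [FD FE]] := perfect_set dD dE.
exists (fun s => ext (F s)); split.
- by move=> s; apply: fg_ext.
- move=> s t st /isomorphic_commutes[x [y [w hF]]].
  have [n] := FE s t st _ x y w erefl.
  by rewrite hF; case: (commutes _ _ _ _ _).
- by move=> s t; apply: Kequiv; apply: DK.
- by move=> s; apply: ext_central.
Qed.
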